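(* For each integer $a\geq 1$, the function $H\mapsto A_a(H)$ on nonnegative integers extends uniquely to a polynomial with rational coefficients, of degree $N_a$ (also denoted $A_a$). Let $\alpha_a=1$ for even $a$ and $\alpha_a=0$ for odd $a$. There is a unique nonzero even polynomial $p_a(c)\in\mathbb{Q}[c]$ such that, as an identity of polynomials in $c$, $$A_a(c-a)=c^{\alpha_a}\binom{c+a-1}{2a-1}\,p_a(c).$$ Its degree and denominator satisfy $$\deg p_a=\left\lfloor\frac{(a-1)^2}{2}\right\rfloor,\qquad \operatorname{den}(p_a)\ \Bigm|\ \frac{N_a!}{(2a-1)!}.$$
   Context: Write $[a]=\{1,\ldots,a\}$. A plane partition in an $(a,a,H)$-box is an integer matrix $\pi=(\pi_{ij})_{(i,j)\in[a]^2}$ with $0\leq\pi_{ij}\leq H$ for all $i,j$, $\pi_{ij}\geq\pi_{i+1,j}$ for $1\leq i<a$, $1\leq j\leq a$, and $\pi_{ij}\geq\pi_{i,j+1}$ for $1\leq i\leq a$, $1\leq j<a$ (the height $H$ is an upper bound and need not be attained). For an integer $H\geq0$, $\mathcal{A}_a(H)$ is the set of plane partitions in an $(a,a,H)$-box such that $\pi_{ij}=\pi_{ji}$ whenever $i+j\neq a+1$, and $A_a(H)=|\mathcal{A}_a(H)|$. Put $N_a=\frac{a(a+1)}{2}+\lfloor a/2\rfloor$. For $f\in\mathbb{Q}[c]$, $\operatorname{den}(f)$ is the least positive integer $D$ such that $Df$ has integer coefficients. Binomials are polynomials: $\binom{x}{k}=\frac{x(x-1)\cdots(x-k+1)}{k!}$,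 $\binom{x}{0}=1$. A polynomial $p$ is even if $p(-c)=p(c)$. *)

(* Defs.v *)
From mathcomp Require Import all_boot all_order all_algebra.

Set Implicit Arguments.
Unset Strict Implicit.
Unset Printing Implicit Defensive.

Import Order.TTheory GRing.Theory Num.Theory.

Local Open Scope ring_scope.

(* Entries in {0, ..., H} are taken in 'I_H.+1, so the bounds are in the type. *)
Definition plane_partition (a H : nat) (x : 'M['I_H.+1]_a) : bool :=
  [forall i : 'I_a, forall i' : 'I_a, forall j : 'I_a,
     ((i' : nat) == i.+1)%N ==> (x i' j <= x i j)%N]
  && [forall i : 'I_a, forall j : 'I_a, forall j' : 'I_a,
     ((j' : nat) == j.+1)%N ==> (x i j' <= x i j)%N].

(* 'I_a is 0-based: the 1-based condition i + j <> a + 1 reads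
   i.+1 + j.+1 <> a.+1. *)
Definition symmetric_off_antidiag (a H : nat) (x : 'M['I_H.+1]_a) : bool :=
  [forall i : 'I_a, forall j : 'I_a,
     (i.+1 + j.+1 != a.+1)%N ==> (x i j == x j i)].

Definition pp_set (a H : nat) : {set 'M['I_H.+1]_a} :=
  [set x | plane_partition x && symmetric_off_antidiag x].

Definition pp_count (a H : nat) : nat := #|pp_set a H|.

Definition pp_deg (a : nat) : nat := ((a * a.+1) %/ 2 + a %/ 2)%N.

Definition alpha (a : nat) : nat := if odd a then 0%N else 1%N.

Definition extends_count (a : nat) (A : {poly rat}) : Prop :=
  forall H : nat, A.[H%:R] = (pp_count a H)%:R.

Definition binom_poly (q : {poly rat}) (k : nat) : {poly rat} :=
  (k`!%:R)^-1 *: \prod_(i < k) (q - (i%:R)%:P).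

Definition even_polynomial (p : {poly rat}) : Prop := p \Po (- 'X) = p.

Definition clears_den (f : {poly rat}) (D : nat) : bool :=
  (0 < D)%N && (D%:R *: f \is a polyOver Num.int).

Lemma clears_den_ex (f : {poly rat}) : exists D : nat, clears_den f D.
Proof.
exists (\prod_(i < size f) `|denq f`_i|)%N; apply/andP; split.
  by apply: prodn_gt0 => i; rewrite absz_gt0 denq_neq0.
apply/polyOverP => i; rewrite coefZ.
have [lt_i | le_i] := ltnP i (size f); last first.
  by rewrite nth_default // mulr0 rpred0.
rewrite (bigD1 (Ordinal lt_i)) //= natrM mulrAC rpredM ?natr_int //.
rewrite natr_absz gtr0_norm ?denq_gt0 // -{2}[f`_i]divq_num_den mulrC.
by rewrite divfK ?intr_int // intr_eq0 denq_neq0.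
Qed.

Definition den (f : {poly rat}) : nat := ex_minn (clears_den_ex f).

Definition factorization (a : nat) (A p : {poly rat}) : Prop :=
  A \Po ('X - (a%:R)%:P)
  = 'X ^+ alpha a * binom_poly ('X + (a%:R)%:P - 1) (2 * a - 1)%N * p.

(* The quotient (pp_deg a)`! %/ (2 * a - 1)`! is exact. *)
Lemma pp_deg_fact_dvd (a : nat) : ((2 * a - 1)`! %| (pp_deg a)`!)%N.
Proof.
have le_deg : (2 * a - 1 <= pp_deg a)%N.
  rewrite /pp_deg; case: a => [|[|[|n]]] //.
  have h : (n.+3 * 2 <= (n.+3 * n.+4) %/ 2)%N.
    by rewrite leq_divRL // -mulnA leq_mul2l.
  apply: leq_trans (leq_addr _ _); apply: leq_trans h.
  by rewrite mulnC leq_subr.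
by rewrite -(bin_fact le_deg) mulnCA dvdn_mulr.
Qed.

(* Main.v *)
Require Import Defs.
From mathcomp Require Import all_boot all_order all_algebra.
From mathcomp Require Import zify ring.

Set Implicit Arguments.
Unset Strict Implicit.
Unset Printing Implicit Defensive.

Import Order.TTheory GRing.Theory Num.Theory.

Local Open Scope ring_scope.

(** The count is an order polynomial. Off the antidiagonal a partition is
    determined by its entries on and above the diagonal, and no symmetry relates
    the entries of the antidiagonal, so A_a(H) counts the order preserving maps
    from a poset of N_a cells to a chain of H + 1 elements. The poset is graded:
    each maximal chain runs from one corner of the square to the opposite one and
    has 2a - 1 elements. Everything follows from three classical facts.

    - Order polynomial. The sequence of sets where a map is smaller than 0, 1, 2,
      ... is a multichain of lower sets. Counting multichains by their
      distinct members writes the count as a combination of the binomials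
      binom(m, k), k <= N, with natural number coefficients: a polynomial [omega]
      of degree N ([size_omega], the top coefficient counting linear extensions)
      which N! makes integral ([omega_int]).

    - Reciprocity ([omega_reciprocity]). Going from m + 1 to m inverts the zeta
      function of the order on lower sets, and its Moebius function is a sign
      supported on the steps that remove an antichain. Hence omega(-m) is, up to
      the sign (-1)^N, the number of strict maps to a chain of m elements.

    - Gradedness. In a graded poset of rank l, subtracting the rank turns the
      strict maps to l + n elements into the weak maps to n elements
      ([card_strict_weak]), and there are none to l elements or fewer
      ([card_strict_small]). So omega vanishes at 0, -1, ..., -l and
      omega(-l - x) = (-1)^N omega(x).

    With l = 2a - 2 and A_a(c - a) = omega(c - a + 1), this says that A_a(c - a)
    has the parity of N and vanishes at the 2a - 1 integers c with |c| < a, that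
    is, at the roots of the odd polynomial binom(c + a - 1, 2a - 1). The quotient
    has parity (-1)^(N + 1), and is therefore again divisible by c when N, or
    equivalently a, is even. Finally c^alpha times the product of the
    2a - 1 linear factors is monic over the integers, so dividing the integral
    polynomial N! A_a(c - a) by it leaves an integral polynomial, which is
    N! / (2a - 1)! times p_a ([symmetric_factorization]). *)

(** * Cardinals and binomial polynomials *)

Lemma leq_card_cancel (S T : finType) (A : {set S}) (B : {set T})
    (f : S -> T) (g : T -> S) :
  {in A, forall x, f x \in B} -> {in A, cancel f g} -> (#|A| <= #|B|)%N.
Proof.
move=> fAB fK; rewrite -(card_in_imset (can_in_inj fK)).
by apply/subset_leq_card/subsetP => _ /imsetP[x xA ->]; apply: fAB.
Qed.

Lemma eq_card_cancel (S T : finType) (A : {set S}) (B : {set T})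
    (f : S -> T) (g : T -> S) :
    {in A, forall x, f x \in B} -> {in A, cancel f g} ->
    {in B, forall y, g y \in A} -> {in B, cancel g f} ->
  #|A| = #|B|.
Proof.
move=> fAB fK gBA gK; apply/eqP; rewrite eqn_leq.
by rewrite (leq_card_cancel fAB fK) (leq_card_cancel gBA gK).
Qed.

Lemma horner_binom_poly k (x : rat) :
  (binom_poly 'X k).[x] = (k`!%:R)^-1 * \prod_(i < k) (x - i%:R).
Proof. by rewrite hornerZ horner_prod; under eq_bigr do rewrite !hornerE. Qed.

Lemma binom_poly0 : binom_poly 'X 0 = 1.
Proof. by rewrite /binom_poly big_ord0 fact0 invr1 scale1r. Qed.

Lemma horner_binom_poly_at0 k : (binom_poly 'X k).[0] = (k == 0)%:R.
Proof.
rewrite horner_binom_poly; case: k => [|k].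
  by rewrite big_ord0 invr1 mulr1.
by rewrite big_ord_recl subrr mul0r mulr0.
Qed.

Lemma horner_binom_poly_pascal k (x : rat) :
  (binom_poly 'X k.+1).[x + 1]
    = (binom_poly 'X k.+1).[x] + (binom_poly 'X k).[x].
Proof.
rewrite !horner_binom_poly big_ord_recl big_ord_recr /= subr0.
under eq_bigr => i _ do rewrite /bump add1n -natr1 opprD addrACA subrr addr0.
set P := \prod_(i < k) _; rewrite factS natrM -natr1.
have fk : k`!%:R != 0 :> rat by rewrite pnatr_eq0 -lt0n fact_gt0.
have k1 : k%:R + 1 != 0 :> rat by rewrite natr1 pnatr_eq0.
by field; apply/andP.
Qed.

Lemma size_binom_poly k : size (binom_poly 'X k) = k.+1.
Proof.
rewrite size_scale ?size_prod_XsubC -?cardE ?card_ord //.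
  by rewrite /index_enum -enumT size_enum_ord.
by rewrite invr_eq0 pnatr_eq0 -lt0n fact_gt0.
Qed.

Lemma binom_poly_int n k : (k <= n)%N ->
  n`!%:R *: binom_poly 'X k \is a polyOver Num.int.
Proof.
move=> le_kn; rewrite scalerA; apply: polyOverZ; last first.
  by apply: rpred_prod => i _; rewrite polyOverXsubC natr_int.
rewrite -(bin_fact le_kn) mulnCA natrM mulrAC divff ?mul1r ?natr_int //.
by rewrite pnatr_eq0 -lt0n fact_gt0.
Qed.

(** * The order polynomial of an acyclic relation *)

Section Monotone.

Variables (T : finType) (R : rel T).

Implicit Types (I J K : {set T}) (b : bool).

(** The possible values of the set where a map on K stays below its top level.
    For [b = false] the set I is closed under R-predecessors in K; for [b = true],
    in addition, no two elements of the complement are related, that is, K minus I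
    consists of R-maximal elements of K. *)
Definition lower b I K : bool :=
  (I \subset K) &&
  [forall x in K, forall y in K,
     R x y ==> (x \in I) || ~~ b && (y \notin I)].

Lemma lowerP b I K :
  reflect (I \subset K /\
           forall x y, x \in K -> y \in K -> R x y ->
             (x \in I) || ~~ b && (y \notin I))
          (lower b I K).
Proof.
apply: (iffP andP) => [] [sIK H]; split=> //.
  move=> x y xK yK Rxy.
  by have /forall_inP/(_ x xK)/forall_inP/(_ y yK)/implyP/(_ Rxy) := H.
apply/forall_inP => x xK; apply/forall_inP => y yK; apply/implyP.
exact: H.
Qed.

(** The flag [b] selects the strict maps. The codomain is a fixed ordinal and the
    value off K is set to 0, so that maps on different K and to chains of
    different lengths m live in a single type; this asks for [m <= B.+1]. *)
Definition order_maps B b K m : {set {ffun T -> 'I_B.+1}} :=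
  [set f : {ffun T -> 'I_B.+1} |
     [forall x, if x \in K then (f x < m)%N else (f x == 0 :> nat)%N]
     && [forall x in K, forall y in K, R x y ==> (f x + b <= f y)%N]].

Lemma order_mapsP B b K m (f : {ffun T -> 'I_B.+1}) :
  reflect [/\ forall x, x \in K -> (f x < m)%N,
              forall x, x \notin K -> f x = ord0
            & forall x y, x \in K -> y \in K -> R x y -> (f x + b <= f y)%N]
          (f \in order_maps B b K m).
Proof.
rewrite inE; apply: (iffP andP) => [[/forallP H1 H2] | [H1 H2 H3]]; split.
- by move=> x xK; have := H1 x; rewrite xK.
- by move=> x /negPf xK; have := H1 x; rewrite xK => /eqP H; apply: val_inj.
- move=> x y xK yK Rxy.
  by have /forall_inP/(_ x xK)/forall_inP/(_ y yK)/implyP/(_ Rxy) := H2.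
- apply/forallP => x; case: ifPn => [|/H2->] //; exact: H1.
- apply/forall_inP => x xK; apply/forall_inP => y yK; apply/implyP.
  exact: H3.
Qed.

Lemma card_order_maps0 B b K : #|order_maps B b K 0| = (K == set0).
Proof.
have [-> | /set0Pn[x xK]] := eqVneq K set0.
  rewrite (_ : order_maps _ _ _ _ = [set [ffun=> ord0]]) ?cards1 //.
  apply/setP => f; rewrite in_set1; apply/order_mapsP/eqP => [[_ H _] | ->].
    by apply/ffunP => x; rewrite ffunE H ?inE.
  by split=> x; rewrite ?ffunE ?inE.
by apply/eqP; rewrite cards_eq0; apply/set0Pn => -[f /order_mapsP[/(_ x xK)]].
Qed.

Definition cut B I (f : {ffun T -> 'I_B.+1}) : {ffun T -> 'I_B.+1} :=
  [ffun x => if x \in I then f x else ord0].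
Definition raise B I K m (f : {ffun T -> 'I_B.+1}) : {ffun T -> 'I_B.+1} :=
  [ffun x => if x \in K :\: I then inord m else f x].

(** Forget the elements that take the top value m: they form the complement of
    some [I] as in [lower], and putting the value m back on K minus I is the
    inverse. *)
Lemma card_order_mapsS B b K m : (m <= B)%N ->
  #|order_maps B b K m.+1| = (\sum_(I | lower b I K) #|order_maps B b I m|)%N.
Proof.
move=> le_mB; have inm : (inord m : 'I_B.+1) = m :> nat by rewrite inordK.
pose low (f : {ffun T -> 'I_B.+1}) := [set x in K | (f x < m)%N].
rewrite -sum1_card (partition_big low (lower b ^~ K)) /=; last first.
  move=> f /order_mapsP[ltf f0 mono]; apply/lowerP; split.
    by apply/subsetP => x; rewrite inE => /andP[].
  move=> x y xK yK Rxy; rewrite !inE xK yK /= -leqNgt.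
  have := mono x y xK yK Rxy; have := ltf x xK; have := ltf y yK.
  by case: b {mono} => /=; lia.
apply: eq_bigr => I /lowerP[sIK lowI].
rewrite sum1dep_card.
apply: (@eq_card_cancel _ _ _ _ (@cut B I) (@raise B I K m)) => f.
- rewrite inE => /andP[/order_mapsP[ltf f0 mono] /eqP defI].
  apply/order_mapsP; split.
  + by move=> x xI; rewrite ffunE xI; move: xI; rewrite -defI inE => /andP[].
  + by move=> x /negPf xI; rewrite ffunE xI.
  + move=> x y xI yI; rewrite !ffunE xI yI.
    by apply: mono; apply: (subsetP sIK).
- rewrite inE => /andP[/order_mapsP[ltf f0 mono] /eqP defI].
  apply/ffunP => x; rewrite !ffunE inE.
  have [//= | xI] := boolP (x \in I).
  have [xK /= | /f0->] := boolP (x \in K) => //=.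
  apply/val_inj; rewrite /= inm; move: xI; rewrite -defI inE xK /=.
  by have := ltf x xK; lia.
- move=> /order_mapsP[ltf f0 mono]; rewrite inE; apply/andP; split; last first.
    apply/eqP/setP => x; rewrite !inE ffunE !inE.
    have [xI | xI] := boolP (x \in I); first by rewrite (subsetP sIK) ?ltf.
    by case: (x \in K); rewrite //= inm ltnn.
  apply/order_mapsP; split.
  + move=> x xK; rewrite ffunE inE xK andbT.
    by have [xI | _] := boolP (x \in I); rewrite /= ?inm // ltnS ltnW ?ltf.
  + move=> x xK; rewrite ffunE inE (negPf xK) andbF f0 //.
    by apply: contra xK; apply: (subsetP sIK).
  + move=> x y xK yK Rxy; rewrite !ffunE !inE xK yK !andbT.
    have := lowI x y xK yK Rxy.
    have [xI | xI] := boolP (x \in I); have [yI | yI] := boolP (y \in I) => //=.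
    * by move=> _; apply: mono.
    * move=> _; have := ltf x xI; rewrite inm.
      by case: b {mono lowI} => /=; lia.
    * by rewrite andbF.
    * by rewrite inm; case: b {mono lowI} => //=; lia.
- move=> /order_mapsP[ltf f0 mono]; apply/ffunP => x; rewrite !ffunE inE.
  by have [//|xI] := boolP (x \in I); rewrite f0.
Qed.

(** For zeta the zeta function of the order [lower false], this is the entry at
    (empty set, K) of the k-th power of zeta - 1: it counts the chains of k
    proper steps from the empty set up to K. *)
Fixpoint nchains (k : nat) K : nat :=
  if k is k'.+1 then (\sum_(I | lower false I K && (I != K)) nchains k' I)%N
  else (K == set0).

Lemma lower_refl K : lower false K K.
Proof. by apply/lowerP; split=> // x y -> ->. Qed.

Lemma lower_sub b I K : lower b I K -> I \subset K.
Proof. by case/andP. Qed.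

Lemma nchains_gt_card k K : (#|K| < k)%N -> nchains k K = 0%N.
Proof.
elim: k K => [//|k IHk] K ltKk /=.
rewrite big1 // => I /andP[/lower_sub sIK neIK]; apply: IHk.
have /proper_card : I \proper K by rewrite properEneq neIK.
by move/leq_trans; apply.
Qed.

Variable h : T -> nat.
Hypothesis h_incr : forall x y, R x y -> (h x < h y)%N.

Lemma ex_highest x0 K : x0 \in K ->
  exists2 x, x \in K & forall y, y \in K -> (h y <= h x)%N.
Proof. by move=> x0K; case: (arg_maxnP h x0K) => x; exists x. Qed.

(** Removing R-maximal elements one at a time gives a chain with as many steps
    as K has elements, that is, a linear extension. *)
Lemma nchains_card_gt0 K : (0 < nchains #|K| K)%N.
Proof.
have [n] := ubnP #|K|; elim: n K => // n IHn K ltKn.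
have [-> | [x0 x0K]] := set_0Vmem K; first by rewrite cards0 /= eqxx.
have [x xK maxx] := ex_highest x0K.
have cK : #|K| = #|K :\ x|.+1 by rewrite (cardsD1 x K) xK.
rewrite cK /= (bigD1 (K :\ x)) /=.
  by rewrite ltn_addr // IHn // -ltnS -cK.
apply/andP; split; last first.
  by apply/eqP => /(congr1 (fun A => #|A : {set _}|)); lia.
apply/lowerP; split=> [|y z yK zK Ryz]; first exact: subD1set.
rewrite !inE yK zK !andbT; case: (y =P x) => //= eyx; subst y.
by have := h_incr Ryz; have := maxx z zK => /=; lia.
Qed.

(** The expansion of the m-th power of zeta = 1 + (zeta - 1), which makes sense at
    every rational m. The range of k depends on T only, so that the polynomials
    of all subsets can be added termwise. *)
Definition omega K : {poly rat} :=
  \sum_(k < #|T|.+1) (nchains k K)%:R *: binom_poly 'X k.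

Lemma lower_trans b I J K : lower false I J -> lower b J K -> lower false I K.
Proof.
move=> /lowerP[sIJ lowI] /lowerP[sJK lowJ]; apply/lowerP; split.
  exact: subset_trans sJK.
move=> x y xK yK Rxy; have [yI | _] := boolP (y \in I); last by rewrite orbT.
have yJ := subsetP sIJ y yI.
have := lowJ x y xK yK Rxy; rewrite yJ andbF orbF => xJ.
by have := lowI x y xJ yJ Rxy; rewrite yI.
Qed.

Definition toggle (x : T) J : {set T} := [set y | (y \in J) (+) (y == x)].

Lemma toggleK x : involutive (toggle x).
Proof. by move=> J; apply/setP => y; rewrite !inE -addbA addbb addbF. Qed.

Lemma sign_toggle x J : (-1) ^+ #|toggle x J| = - (-1) ^+ #|J| :> rat.
Proof.
have eqD : toggle x J :\ x = J :\ x.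
  by apply/setP => y; rewrite !inE; case: (y == x); rewrite ?addbF.
rewrite (cardsD1 x J) (cardsD1 x (toggle x J)) eqD inE eqxx addbT.
by case: (x \in J); rewrite /= !add1n !add0n exprS ?mulN1r ?opprK.
Qed.

(** The signed steps that remove maximal elements are inverse to zeta. If I is a
    proper lower set of K, then an element x of maximal height in the complement
    of I is R-maximal in K, and moving x in or out of J is a fixed-point-free
    involution that reverses the sign. *)
Lemma signed_sum_lower I K :
  \sum_(J | lower true J K && lower false I J) (-1) ^+ #|J|
    = (if I == K then (-1) ^+ #|K| else 0) :> rat.
Proof.
have [-> | neIK] := eqVneq I K.
  rewrite (big_pred1 K) // => J.
  apply/andP/eqP => [[/lower_sub ? /lower_sub ?] | ->].
    by apply/eqP; rewrite eqEsubset; apply/andP.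
  split; last exact: lower_refl.
  by apply/lowerP; split=> // x y ->.
have [/existsP[J0 /andP[low0K lowI0]] | none] :=
    boolP [exists J, lower true J K && lower false I J]; last first.
  rewrite big_pred0 // => J; apply/negbTE.
  by apply: contra none => ?; apply/existsP; exists J.
have /lowerP[sIK lowI] := lower_trans lowI0 low0K.
have [x0] : exists x0, x0 \in K :\: I.
  apply/set0Pn; rewrite setD_eq0; apply: contra neIK => ?.
  by rewrite eqEsubset sIK.
move=> x0KI; have [x xKI maxx] := ex_highest x0KI.
have /setDP[xK xI] := xKI.
(* An R-successor of x in K cannot lie in I, which is closed under
   predecessors, nor outside I, where x is highest. *)
have xmax y : y \in K -> ~~ R x y.
  move=> yK; apply/negP => Rxy; have := lowI x y xK yK Rxy.
  rewrite (negPf xI) /= => yI; have := maxx y; rewrite /= inE yI yK.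
  by move/(_ isT); have := h_incr Rxy; lia.
suff tog J : lower true J K && lower false I J ->
    lower true (toggle x J) K && lower false I (toggle x J).
  set S := LHS; suff : S = - S.
    by move/eqP; rewrite -addr_eq0 -mulr2n mulrn_eq0 => /eqP.
  rewrite {1}/S (reindex_inj (inv_inj (toggleK x))) /= -sumrN.
  apply: eq_big => J; last by move=> _; rewrite sign_toggle.
  by apply/idP/idP => [/tog|/tog //]; rewrite toggleK.
case/andP=> /lowerP[sJK lowJK] /lowerP[sIJ lowIJ].
have sJ'K : toggle x J \subset K.
  apply/subsetP => y; rewrite inE; case: eqP => [-> //|_]; rewrite addbF.
  exact: (subsetP sJK).
apply/andP; split; apply/lowerP; split=> //.
- move=> y z yK zK Ryz; rewrite !inE.
  have := lowJK y z yK zK Ryz.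
  case: eqP => [eyx|_]; last by rewrite addbF !orbF.
  by have := xmax z zK; rewrite -eyx Ryz.
- apply/subsetP => y yI; rewrite inE (subsetP sIJ) //; case: eqP => // eyx.
  by rewrite -eyx yI in xI.
- move=> y z /(subsetP sJ'K) yK /(subsetP sJ'K) zK Ryz; exact: lowI.
Qed.

Lemma omega_at0 K : (omega K).[0] = (K == set0)%:R.
Proof.
rewrite horner_sum (bigD1 ord0) //= big1 => [|i ne0].
  by rewrite hornerZ horner_binom_poly_at0 mulr1 addr0.
by rewrite hornerZ horner_binom_poly_at0 (negPf (ne0 : (i : nat) != 0%N)) mulr0.
Qed.

(** By Pascal's rule the increment of [omega K] shifts the chain lengths by one,
    and a chain of k + 1 steps ending at K is a chain of k steps ending at some
    proper lower set of K. *)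
Lemma omegaS K (x : rat) :
  (omega K).[x + 1] = \sum_(I | lower false I K) (omega I).[x].
Proof.
have hornerw J y : (omega J).[y] =
    \sum_(k < #|T|.+1) (nchains k J)%:R * (binom_poly 'X k).[y].
  by rewrite horner_sum; apply: eq_bigr => k _; rewrite hornerZ.
rewrite (bigD1 (P := fun I => lower false I K) K (lower_refl K)) /= !hornerw.
under [X in _ = _ + X]eq_bigr do rewrite hornerw.
rewrite exchange_big /= big_ord_recl [X in _ = X + _]big_ord_recl /=.
rewrite binom_poly0 !hornerC -addrA; congr (_ + _).
rewrite big_ord_recr /= [X in _ = _ + (_ + X)]big1; last first.
  move=> I /andP[sI neI].
  rewrite nchains_gt_card ?mul0r //.
  have := max_card (mem K); apply: leq_trans; apply: proper_card.
  by rewrite properEneq neI (lower_sub sI).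
rewrite addr0 -big_split /=; apply: eq_bigr => k _.
rewrite /bump /= add1n horner_binom_poly_pascal mulrDr -mulr_suml natr_sum.
by [].
Qed.

Lemma omega_order_maps B K m : (m <= B.+1)%N ->
  (omega K).[m%:R] = #|order_maps B false K m|%:R.
Proof.
elim: m K => [|m IHm] K le_mB; first by rewrite omega_at0 card_order_maps0.
rewrite -natr1 omegaS card_order_mapsS // natr_sum.
by apply: eq_bigr => I _; rewrite IHm // ltnW.
Qed.

(** Inverting the recurrence [omegaS] at every rational point, which also allows
    stepping down to negative integers. *)
Lemma omega_inversion K (x : rat) :
  \sum_(J | lower true J K) (-1) ^+ #|J| * (omega J).[x + 1]
    = (-1) ^+ #|K| * (omega K).[x].
Proof.
under eq_bigr => J _ do rewrite omegaS mulr_sumr.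
rewrite (exchange_big_dep xpredT) //=.
rewrite (bigD1 K) //= [X in _ + X]big1 => [|I neIK].
  by rewrite -mulr_suml signed_sum_lower eqxx addr0.
by rewrite -mulr_suml signed_sum_lower (negPf neIK) mul0r.
Qed.

(** The inverted recurrence at negative integers is the recurrence
    [card_order_mapsS] for strict maps, up to the sign given by the parity of
    the set. *)
Lemma omega_reciprocity B K m : (m <= B.+1)%N ->
  (omega K).[- m%:R] = (-1) ^+ #|K| * #|order_maps B true K m|%:R.
Proof.
move=> le_mB.
suff <- : (-1) ^+ #|K| * (omega K).[- m%:R] = #|order_maps B true K m|%:R.
  by rewrite signrMK.
elim: m K le_mB => [|m IHm] K le_mB.
  rewrite mulr0n oppr0 omega_at0 card_order_maps0.
  by case: eqP => [->|_]; rewrite ?mulr0 // cards0 mul1r.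
rewrite card_order_mapsS // natr_sum -omega_inversion.
apply: eq_bigr => J _; rewrite -IHm; last exact: ltnW.
by rewrite -natr1 opprD subrK.
Qed.

Lemma omega_trunc K :
  omega K = \sum_(k < #|K|.+1) (nchains k K)%:R *: binom_poly 'X k.
Proof.
have le_card : (#|K|.+1 <= #|T|.+1)%N by rewrite ltnS max_card.
pose term k := (nchains k K)%:R *: binom_poly 'X k.
rewrite /omega (big_ord_widen _ term le_card).
rewrite [RHS]big_mkcond /=; apply: eq_bigr => k _.
by case: ltnP => // lt_Kk; rewrite nchains_gt_card ?scale0r.
Qed.

(** The leading coefficient is [nchains #|K| K] divided by a factorial. *)
Lemma size_omega K : size (omega K) = #|K|.+1.
Proof.
have nz : (nchains #|K| K)%:R != 0 :> rat.
  by rewrite pnatr_eq0 -lt0n nchains_card_gt0.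
rewrite omega_trunc big_ord_recr /= addrC.
rewrite size_polyDl size_scale ?size_binom_poly //.
apply: leq_ltn_trans (size_sum _ _ _) _; rewrite ltnS.
apply/bigmax_leqP => k _; apply: leq_trans (size_scale_leq _ _) _.
by rewrite size_binom_poly.
Qed.

Lemma omega_int K : #|K|`!%:R *: omega K \is a polyOver Num.int.
Proof.
rewrite omega_trunc scaler_sumr; apply/polyOverP => i.
rewrite coef_sum; apply: rpred_sum => k _.
rewrite scalerA mulrC -scalerA coefZ; apply: rpredM; first exact: natr_int.
have /binom_poly_int/polyOverP : (k <= #|K|)%N by rewrite -ltnS.
exact.
Qed.

End Monotone.

(** * Graded relations *)

Lemma poly_nat_ext (p q : {poly rat}) :
  (forall n : nat, p.[n%:R] = q.[n%:R]) -> p = q.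
Proof.
move=> eqpq; apply/eqP; rewrite -subr_eq0; apply/negP => /negP nz.
have := max_poly_roots nz (rs := [seq n%:R | n <- iota 0 (size (p - q))]).
rewrite size_map size_iota ltnn => /(_ _ _)/negP; apply=> //.
  by apply/allP => _ /mapP[n _ ->]; rewrite rootE !hornerE eqpq subrr.
by rewrite map_inj_uniq ?iota_uniq // => m n /eqP; rewrite eqr_nat => /eqP.
Qed.

Section Graded.

Variables (T : finType) (R : rel T) (K : {set T}) (h : T -> nat) (l : nat).

Hypothesis h_cover : forall x y, R x y -> h y = (h x).+1.
Hypothesis h_le : forall x, x \in K -> (h x <= l)%N.
Hypothesis h_down : forall x, x \in K -> (0 < h x)%N ->
  exists2 y, y \in K & R y x.
Hypothesis h_up : forall x, x \in K -> (h x < l)%N ->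
  exists2 y, y \in K & R x y.

(** Descend from x to rank 0 along R: the value drops at each of the h x steps. *)
Lemma strict_ge_rank B m (f : {ffun T -> 'I_B.+1}) x :
  f \in order_maps R B true K m -> x \in K -> (h x <= f x)%N.
Proof.
move=> /order_mapsP[_ _ mono]; have [n] := ubnP (h x).
elim: n x => // n IHn x lt_n xK.
have [-> // | h_gt0] := posnP (h x).
have [y yK Ryx] := h_down xK h_gt0.
have := h_cover Ryx; have /= := mono y x yK xK Ryx.
have : (h y <= f y)%N by apply: IHn; rewrite // (h_cover Ryx) in lt_n *.
lia.
Qed.

(** Climb from x to rank l along R: the value grows at each of the l - h x
    steps. *)
Lemma strict_lt_corank B m (f : {ffun T -> 'I_B.+1}) x :
  f \in order_maps R B true K m -> x \in K -> (f x + (l - h x) < m)%N.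
Proof.
move=> /order_mapsP[ltf _ mono]; have [n] := ubnP (l - h x).
elim: n x => // n IHn x lt_n xK.
have [lt_xl | le_lx] := ltnP (h x) l; last by have := ltf x xK; lia.
have [y yK Rxy] := h_up xK lt_xl.
have hy := h_cover Rxy; have /= := mono x y xK yK Rxy.
have : (f y + (l - h y) < m)%N by apply: IHn => //; lia.
lia.
Qed.

Lemma card_strict_small B m : K != set0 -> (m <= l)%N ->
  #|order_maps R B true K m| = 0%N.
Proof.
case/set0Pn => x xK le_ml; apply/eqP; rewrite cards_eq0.
apply/set0Pn => -[f fP]; have := strict_ge_rank fP xK.
by have := strict_lt_corank fP xK; have := h_le xK; lia.
Qed.

(** The bijection subtracts the rank. The difference stays between 0 and n - 1
    by the two bounds on strict maps, and adding the rank back to a weak map makes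
    it strict. *)
Lemma card_strict_weak B n : (l + n <= B.+1)%N ->
  #|order_maps R B true K (l + n)| = #|order_maps R B false K n|.
Proof.
move=> leB.
pose shift (s : nat -> nat -> nat) (f : {ffun T -> 'I_B.+1})
    : {ffun T -> 'I_B.+1} :=
  [ffun x => if x \in K then inord (s (f x) (h x)) else ord0].
have shiftE (s : nat -> nat -> nat) (f : {ffun T -> 'I_B.+1}) x :
    x \in K -> (s (f x) (h x) <= B)%N -> shift s f x = s (f x) (h x) :> nat.
  by move=> xK les; rewrite ffunE xK inordK.
have shift0 (s : nat -> nat -> nat) (f : {ffun T -> 'I_B.+1}) x :
    x \notin K -> shift s f x = ord0.
  by move=> /negPf xK; rewrite ffunE xK.
have subE (f : {ffun T -> 'I_B.+1}) x :
    x \in K -> shift subn f x = (f x - h x)%N :> nat.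
  by move=> xK; rewrite shiftE //; have := ltn_ord (f x); lia.
have addE (f : {ffun T -> 'I_B.+1}) x :
    f \in order_maps R B false K n -> x \in K ->
    shift addn f x = (f x + h x)%N :> nat.
  move=> /order_mapsP[ltf _ _] xK; rewrite shiftE //.
  by have := ltf x xK; have := h_le xK; lia.
apply: (@eq_card_cancel _ _ _ _ (shift subn) (shift addn)) => f fP.
- have /order_mapsP[_ _ mono] := fP; apply/order_mapsP; split; last 2 first.
  + by move=> x /shift0->.
  + move=> x y xK yK Rxy; rewrite !subE // (h_cover Rxy) addn0.
    by have /= := mono x y xK yK Rxy; lia.
  + move=> x xK; rewrite subE //.
    have := strict_lt_corank fP xK; have := strict_ge_rank fP xK.
    by have := h_le xK; lia.
- have /order_mapsP[_ f0 _] := fP; apply/ffunP => x; apply/val_inj => /=.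
  have [xK | xK] := boolP (x \in K); last by rewrite shift0 // f0.
  have ge := strict_ge_rank fP xK.
  by rewrite shiftE // subE // subnK // -ltnS.
- have /order_mapsP[ltf _ mono] := fP; apply/order_mapsP; split.
  + by move=> x xK; rewrite addE //; have := ltf x xK; have := h_le xK; lia.
  + by move=> x /shift0->.
  + move=> x y xK yK Rxy; rewrite !addE // (h_cover Rxy).
    by have /= := mono x y xK yK Rxy; lia.
- have /order_mapsP[_ f0 _] := fP; apply/ffunP => x; apply/val_inj => /=.
  have [xK | xK] := boolP (x \in K); last by rewrite shift0 // f0.
  by rewrite subE // addE // addnK.
Qed.

Let h_incr x y : R x y -> (h x < h y)%N.
Proof. by move=> /h_cover->. Qed.

Lemma omega_root m : K != set0 -> (m <= l)%N -> (omega R K).[- m%:R] = 0.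
Proof.
move=> K0 le_ml; rewrite (omega_reciprocity h_incr K (leqnSn m)).
by rewrite card_strict_small ?mulr0.
Qed.

(** Reciprocity combined with the rank shift gives the identity at all natural
    numbers, hence as an identity of polynomials. *)
Lemma omega_symmetry (x : rat) :
  (omega R K).[- (l%:R + x)] = (-1) ^+ #|K| * (omega R K).[x].
Proof.
have /(congr1 (horner^~ x)) : omega R K \Po (- (l%:R%:P + 'X))
    = (-1) ^+ #|K| *: omega R K.
  apply: poly_nat_ext => n; rewrite horner_comp !hornerE -natrD.
  rewrite (omega_reciprocity h_incr K (leqnSn _)) card_strict_weak ?leqnSn //.
  by rewrite (@omega_order_maps _ _ (l + n) K) // ltnW // ltnS leq_addl.
by rewrite horner_comp !hornerE.
Qed.

End Graded.

(** * Symmetric polynomials vanishing at |c| < a *)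

(** Division by a monic integer polynomial stays over the integers, and
    quotient and remainder are unique over the rationals. *)
Lemma polyOver_int_monic_quotient (g p : {poly rat}) :
  g \is monic -> g \is a polyOver Num.int -> g * p \is a polyOver Num.int ->
  p \is a polyOver Num.int.
Proof.
move=> gmon /floorpP[g' defg0] /floorpP[f' deff0].
pose toQ (u : {poly int}) : {poly rat} := map_poly intr u.
have defg : g = toQ g' := defg0; have deff : g * p = toQ f' := deff0.
have g'mon : g' \is monic.
  move: gmon; rewrite defg !monicE lead_coef_map_inj //; last exact: intr_inj.
  by rewrite -[1]/(1%:~R) eqr_int.
have /(congr1 toQ) := Pdiv.RingMonic.rdivp_eq g'mon f'.
rewrite -deff [RHS]rmorphD /= [X in X + _]rmorphM /= -/(toQ g') -defg.
set q := map_poly _ _; set r := map_poly _ _ => /eqP.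
rewrite addrC -subr_eq mulrC -mulrBl => /eqP eqr.
have ltr : (size r < size g)%N.
  rewrite defg !size_map_inj_poly //; try exact: intr_inj.
  by rewrite Pdiv.Ring.ltn_rmodp monic_neq0.
have : p - q = 0.
  apply: contraTeq ltr => nz; rewrite -leqNgt -eqr mulrC size_monicM //.
  move: nz; rewrite -size_poly_gt0; case: (size (p - q)) => // d _.
  by rewrite addnS leq_addr.
move/eqP; rewrite subr_eq0 => /eqP->.
by apply/polyOverP => i; rewrite coef_map intr_int.
Qed.

(** The integers that clear the denominators form an ideal, generated by its least
    positive element. *)
Lemma den_dvd (f : {poly rat}) (D : nat) :
  (0 < D)%N -> D%:R *: f \is a polyOver Num.int -> (den f %| D)%N.
Proof.
move=> D_gt0 Df; rewrite /den; case: ex_minnP => d /andP[d_gt0 df] dmin.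
rewrite /dvdn; have [//|r_gt0] := posnP (D %% d).
suff /dmin : clears_den f (D %% d) by rewrite leqNgt ltn_mod d_gt0.
rewrite /clears_den r_gt0; apply/polyOverP => i.
have -> : ((D %% d)%:R *: f)`_i = (D%:R *: f)`_i - (D %/ d)%:R * (d%:R *: f)`_i.
  by rewrite !coefZ mulrA -natrM -mulrBl {2}(divn_eq D d) natrD addrC addKr.
by rewrite rpredB ?rpredM ?natr_int ?(polyOverP Df) ?(polyOverP df).
Qed.
Definition root_prod (a : nat) : {poly rat} :=
  \prod_(i < (2 * a - 1)%N) ('X - (i%:R - (a%:R - 1))%:P).

Lemma binom_poly_root_prod a :
  binom_poly ('X + a%:R%:P - 1) (2 * a - 1)
    = ((2 * a - 1)`!%:R)^-1 *: root_prod a.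
Proof.
congr (_ *: _); apply: eq_bigr => i _.
by rewrite !polyCB; ring.
Qed.

(** Reversing the order of the factors negates each root, and there are an odd
    number of factors. *)
Lemma root_prod_odd a : (0 < a)%N -> root_prod a \Po (- 'X) = - root_prod a.
Proof.
move=> a_gt0; rewrite /root_prod rmorph_prod /= (reindex_inj rev_ord_inj) /=.
rewrite -[RHS]mulN1r; have -> : -1 = \prod_(i < (2 * a - 1)%N) -1 :> {poly rat}.
  rewrite prodr_const card_ord -signr_odd oddB ?oddM //=; lia.
rewrite -big_split /=; apply: eq_bigr => i _.
have -> : (2 * a - 1 - i.+1)%N%:R - (a%:R - 1) = - (i%:R - (a%:R - 1)) :> rat.
  rewrite !natrB ?natrM ?ltn_ord //; last by lia.
  by rewrite -[i.+1]addn1 natrD; ring.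
by rewrite comp_polyB comp_polyX comp_polyC polyCN; ring.
Qed.

Lemma root_prod_monic a : root_prod a \is monic.
Proof. exact: monic_prod_XsubC. Qed.

Lemma size_root_prod a : size (root_prod a) = (2 * a - 1).+1.
Proof.
by rewrite size_prod_XsubC /index_enum -enumT size_enum_ord.
Qed.

Lemma root_prod_over (S : subringClosed rat) a e :
  'X ^+ e * root_prod a \is a polyOver S.
Proof.
rewrite rpredM ?polyOverXn //; apply: rpred_prod => i _.
by rewrite polyOverXsubC !rpredB ?rpred_nat ?rpred1.
Qed.

Lemma root_prod_dvd a (F : {poly rat}) :
  (forall i, (i < 2 * a - 1)%N -> F.[i%:R - (a%:R - 1)] = 0) ->
  exists q, F = q * root_prod a.
Proof.
move=> rootF; pose s := [seq i%:R - (a%:R - 1) : rat | i <- iota 0 (2 * a - 1)].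
have rootS : all (root F) s.
  by apply/allP => x /mapP[i]; rewrite mem_iota => /rootF ri ->; apply/rootP.
have uniqS : uniq_roots s.
  rewrite uniq_rootsE map_inj_uniq ?iota_uniq // => i j /addIr/eqP.
  by rewrite eqr_nat => /eqP.
have [q defF] := uniq_roots_prod_XsubC rootS uniqS; exists q.
rewrite defF big_map -{1}[(2 * a - 1)%N]subn0 -/(index_iota _ _) big_mkord.
by [].
Qed.

(** With G the monic integral polynomial c^e times the product of the linear
    factors, F = G r for some r. When e = 1, the exponent N is even, so the
    quotient of F by the odd product of linear factors is odd and has the further
    root 0. As G and F have the same parity, r is even; and the polynomial p is
    (2a - 1)! r, where the factorial is the denominator of the binomial. *)
Lemma symmetric_factorization (a N e : nat) (F : {poly rat}) :
  (0 < a)%N -> odd (N + e) -> (e <= 1)%N -> size F = N.+1 ->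
  F \Po (- 'X) = (-1) ^+ N *: F ->
  (forall i, (i < 2 * a - 1)%N -> F.[i%:R - (a%:R - 1)] = 0) ->
  N`!%:R *: F \is a polyOver Num.int ->
  ((2 * a - 1)`! %| N`!)%N ->
  exists p : {poly rat},
    [/\ unique (fun q => q != 0 /\ even_polynomial q /\
          F = 'X ^+ e * binom_poly ('X + a%:R%:P - 1) (2 * a - 1) * q) p,
        (size p + (2 * a - 1) + e = N.+1)%N
      & (den p %| N`! %/ (2 * a - 1)`!)%N].
Proof.
move=> a_gt0 oddNe e_le1 sizeF symF rootF intF dvdN.
have [q0 defF0] := root_prod_dvd rootF.
pose G := 'X ^+ e * root_prod a.
have B0 : root_prod a != 0 by rewrite monic_neq0 ?root_prod_monic.
have [r defF] : exists r, F = G * r.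
  have [e0 | e_gt0] := posnP e.
    by exists q0; rewrite /G e0 mul1r mulrC.
  have {e_le1 e_gt0} e1 : e = 1%N by lia.
  have evN : (-1) ^+ N = 1 :> rat.
    by rewrite -signr_odd; move: oddNe; rewrite e1 addn1 /= => /negPf->.
  have q0odd : q0 \Po (- 'X) = - q0.
    apply: (mulIf B0); apply: oppr_inj; rewrite -mulrN -root_prod_odd //.
    by rewrite -comp_polyM -defF0 symF evN scale1r mulNr opprK.
  have : root q0 0.
    have /(congr1 (horner^~ 0)) := q0odd; rewrite horner_comp !hornerE oppr0.
    by move/eqP; rewrite -addr_eq0 -mulr2n mulrn_eq0.
  case/factor_theorem => r; rewrite subr0 => def_q0; exists r.
  by rewrite defF0 def_q0 /G e1; ring.
have Gmon : G \is monic by rewrite monicMl ?monicXn ?root_prod_monic.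
have G0 := monic_neq0 Gmon.
have F0 : F != 0 by rewrite -size_poly_gt0 sizeF.
have r0 : r != 0 by apply: contraNneq F0 => r0; rewrite defF r0 mulr0.
have Gsym : G \Po (- 'X) = (-1) ^+ N *: G.
  rewrite /G comp_polyM root_prod_odd // rmorphXn /= comp_polyX (exprNn 'X).
  have -> : (-1) ^+ N = - (-1) ^+ e :> rat.
    rewrite -signr_odd -[in RHS]signr_odd; move: oddNe; rewrite oddD.
    by case: (odd N); case: (odd e); rewrite //= ?opprK.
  by rewrite -mul_polyC polyCN polyC_exp polyCN polyC1 mulrN mulNr mulrA.
have r_even : r \Po (- 'X) = r.
  apply: (mulfI G0); apply: (scalerI (_ : (-1) ^+ N != 0 :> rat)).
    by rewrite signr_eq0.
  by rewrite scalerAl -Gsym -comp_polyM -defF symF.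
set f := (2 * a - 1)`!%:R : rat.
have f0 : f != 0 by rewrite pnatr_eq0 -lt0n fact_gt0.
have factorE p : ('X ^+ e * binom_poly ('X + a%:R%:P - 1) (2 * a - 1) * p)
    = f^-1 *: (G * p).
  by rewrite binom_poly_root_prod -scalerAr -scalerAl.
exists (f *: r); split.
- split.
    split; first by rewrite scaler_eq0 negb_or f0.
    split; first by rewrite /even_polynomial comp_polyZ r_even.
    by rewrite factorE -scalerAr scalerA mulVf // scale1r.
  move=> q [_ [_]]; rewrite factorE defF => defq.
  apply: (mulfI G0); rewrite -scalerAr defq scalerA mulfV // scale1r.
  by [].
- move: sizeF; rewrite defF size_monicM // size_monicM ?monicXn //.
  rewrite size_polyXn size_root_prod size_scale //.
  move: r0; rewrite -size_poly_gt0; move: (size _) => s; lia.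
- apply: den_dvd; first by rewrite divn_gt0 ?fact_gt0 // dvdn_leq ?fact_gt0.
  apply: (polyOver_int_monic_quotient Gmon).
    exact: root_prod_over.
  rewrite scalerA -natrM divnK // -scalerAr -defF.
  exact: intF.
Qed.

(** * The poset of cells *)

Section SymmetricPartitions.

Variable a : nat.

Implicit Types u v : 'I_a * 'I_a.

(** One cell for each entry that can be chosen freely: both mirror images on the
    antidiagonal, and the one on or above the diagonal elsewhere. In the 0-based
    indexing the antidiagonal is i + j = a - 1. *)
Definition cells : {set 'I_a * 'I_a} :=
  [set u : 'I_a * 'I_a | (u.1 <= u.2)%N || (u.1 + u.2 == a.-1)%N].

(** The entry at u lies one step below or to the right of the entry at v, up to
    transposing either of the two cells: the sorted coordinates of u are those of
    v with one coordinate raised by 1. Entries of a partition weakly increase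
    from u to v. *)
Definition below : rel ('I_a * 'I_a) := fun u v =>
  [&& (u.1 + u.2 == (v.1 + v.2).+1)%N,
      (minn v.1 v.2 <= minn u.1 u.2)%N & (maxn v.1 v.2 <= maxn u.1 u.2)%N].

(** Since [below] goes toward smaller indices, the rank that increases along it
    counts steps from the last corner. *)
Definition corank u : nat := (2 * a - 2 - (u.1 + u.2))%N.

(** The columns j < n of the cells in row i, with m in the role of a - 1: those
    with i <= j, and possibly the one antidiagonal cell to their left. *)
Lemma sum_row_cells i m n :
  (\sum_(0 <= j < n) ((i <= j) || (i + j == m)) =
     (n - i) + [&& i <= m, m < i + i & m - i < n])%N.
Proof.
elim: n => [|n IHn]; first by rewrite big_nil andbF andbF.
rewrite big_nat_recr //= IHn; lia.
Qed.

Lemma card_cells : #|cells| = pp_deg a.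
Proof.
have -> : #|cells| = (\sum_(i < a) ((a - i) + (a <= i + i)))%N.
  rewrite -sum1dep_card big_mkcond /= -(pair_big xpredT xpredT
    (fun i j : 'I_a => if (i <= j) || (i + j == a.-1) then 1 else 0)%N) /=.
  apply: eq_bigr => i _; have lt_i := ltn_ord i.
  have -> : (a <= i + i = [&& i <= a.-1, a.-1 < i + i & a.-1 - i < a])%N by lia.
  rewrite -sum_row_cells big_mkord.
  by apply: eq_bigr => j _; case: (_ || _).
rewrite big_split /=; congr (_ + _)%N.
  rewrite (reindex_inj rev_ord_inj) /=.
  under eq_bigr => i _ do rewrite subKn ?ltn_ord //.
  rewrite -(big_mkord xpredT (fun i => i.+1)); set s := (\sum_(_ <= _ < _) _)%N.
  suff <- : (s * 2)%N = (a * a.+1)%N by rewrite mulnK.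
  rewrite {}/s; elim: a => [|n IHn]; first by rewrite big_nil.
  by rewrite big_nat_recr //= mulnDl IHn; lia.
rewrite -(big_mkord xpredT (fun i => (a <= i + i)%N : nat)).
suff count n : (\sum_(0 <= i < n) (a <= i + i))%N = (n - (a.+1 %/ 2))%N.
  by rewrite count; lia.
elim: n => [|n IHn]; first by rewrite big_nil.
by rewrite big_nat_recr //= IHn; lia.
Qed.

Lemma corank_below u v : below u v -> corank v = (corank u).+1.
Proof.
move=> /and3P[/eqP s _ _]; rewrite /corank.
by have := ltn_ord u.1; have := ltn_ord u.2; lia.
Qed.

Lemma corank_le u : u \in cells -> (corank u <= 2 * a - 2)%N.
Proof. by rewrite leq_subr. Qed.

Lemma below_up u : u \in cells -> (0 < corank u)%N ->
  exists2 v, v \in cells & below v u.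
Proof.
move=> _; case: u => i j; rewrite /corank /= => pos.
have := ltn_ord i; have := ltn_ord j => lt_j lt_i.
have [lt_max | ge_max] := ltnP (maxn i j).+1 a.
  have lt_min : (minn i j < a)%N by lia.
  exists (Ordinal lt_min, Ordinal lt_max); first by rewrite inE /=; lia.
  by apply/and3P; split=> /=; lia.
have lt_min : ((minn i j).+1 < a)%N by lia.
have lt_max : (maxn i j < a)%N by lia.
exists (Ordinal lt_min, Ordinal lt_max); first by rewrite inE /=; lia.
by apply/and3P; split=> /=; lia.
Qed.

Lemma below_down u : u \in cells -> (corank u < 2 * a - 2)%N ->
  exists2 v, v \in cells & below u v.
Proof.
move=> _; case: u => i j; rewrite /corank /= => pos.
have := ltn_ord i; have := ltn_ord j => lt_j lt_i.
have lt_max : (maxn i j < a)%N by lia.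
have lt_max' : ((maxn i j).-1 < a)%N by lia.
have lt_min : ((minn i j) < a)%N by lia.
have lt_min' : ((minn i j).-1 < a)%N by lia.
have [min0 | min_gt0] := posnP (minn i j).
  exists (Ordinal lt_min, Ordinal lt_max'); first by rewrite inE /=; lia.
  by apply/and3P; split=> /=; lia.
exists (Ordinal lt_min', Ordinal lt_max); first by rewrite inE /=; lia.
by apply/and3P; split=> /=; lia.
Qed.

Definition rep i j : 'I_a * 'I_a := if (i, j) \in cells then (i, j) else (j, i).

Lemma rep_cells i j : rep i j \in cells.
Proof.
by rewrite /rep; case: ifP => // /negbT; rewrite !inE /=; lia.
Qed.

Lemma rep_id u : u \in cells -> rep u.1 u.2 = u.
Proof. by rewrite /rep -surjective_pairing => ->. Qed.

Lemma rep_sym (i j : 'I_a) : (i.+1 + j.+1 != a.+1)%N -> rep i j = rep j i.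
Proof.
rewrite /rep !inE /= => ne; have lt_i := ltn_ord i.
have -> : (i + j == a.-1)%N = false by lia.
have -> : (j + i == a.-1)%N = false by lia.
rewrite !orbF; case: ltngtP => // /val_inj->.
by [].
Qed.

Lemma below_rep (i j i' j' : 'I_a) :
  below (rep i' j') (rep i j) = below (i', j') (i, j).
Proof.
by rewrite /rep; do 2!case: ifP => _;
  rewrite /below /= ?[minn j i]minnC ?[minn j' i']minnC
    ?[maxn j i]maxnC ?[maxn j' i']maxnC ?[(j + i)%N]addnC ?[(j' + i')%N]addnC.
Qed.

Variable H : nat.

Implicit Types x : 'M['I_H.+1]_a.

Lemma pp_setP x :
  reflect [/\ forall i i' j : 'I_a, i' = i.+1 :> nat -> (x i' j <= x i j)%N,
              forall i j j' : 'I_a, j' = j.+1 :> nat -> (x i j' <= x i j)%N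
            & forall i j : 'I_a, (i.+1 + j.+1 != a.+1)%N -> x i j = x j i]
          (x \in pp_set a H).
Proof.
rewrite inE; apply: (iffP andP) => [[/andP[rowx colx] symx] | [rowx colx symx]].
  split.
  - move=> i i' j /eqP e.
    by move/forallP/(_ i)/forallP/(_ i')/forallP/(_ j)/implyP: rowx; apply.
  - move=> i j j' /eqP e.
    by move/forallP/(_ i)/forallP/(_ j)/forallP/(_ j')/implyP: colx; apply.
  - move=> i j e; apply/eqP.
    by move/forallP/(_ i)/forallP/(_ j)/implyP: symx; apply.
split; first (apply/andP; split).
- apply/forallP => i; apply/forallP => i'; apply/forallP => j.
  by apply/implyP => /eqP; apply: rowx.
- apply/forallP => i; apply/forallP => j; apply/forallP => j'.
  by apply/implyP => /eqP; apply: colx.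
- apply/forallP => i; apply/forallP => j; apply/implyP => e.
  by apply/eqP; apply: symx.
Qed.

(** Two cells related by [below] have different coordinate sums, so at most one
    of them lies on the antidiagonal, and the other one may be transposed to make
    the two cells adjacent. *)
Lemma pp_below x u v : x \in pp_set a H -> below u v ->
  (x u.1 u.2 <= x v.1 v.2)%N.
Proof.
case: u v => [i j] [i' j'] /pp_setP[rowx colx symx] /and3P[/= /eqP s mn mx].
have direct (k l k' l' : 'I_a) : (k + l)%N = (k' + l').+1 -> (k' <= k)%N ->
    (l' <= l)%N -> (x k l <= x k' l')%N.
  move=> skl le_k le_l; have [lt_k | ge_k] := ltnP k' k.
    by have -> : l = l' by [apply: val_inj => /=; lia]; apply: rowx; lia.
  by have -> : k = k' by [apply: val_inj => /=; lia]; apply: colx; lia.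
have [[le_i le_j] | [le_i le_j]] :
    ((i' <= i) /\ (j' <= j) \/ (j' <= i) /\ (i' <= j))%N by lia.
  exact: direct.
(* Here the cells are adjacent after one transposition: transpose the one that
   is off the antidiagonal. *)
have [antidiag | off] := eqVneq (i'.+1 + j'.+1)%N a.+1; last first.
  by rewrite (symx _ _ off); apply: direct; lia.
by rewrite symx; [apply: direct; lia | lia].
Qed.

Definition pp_to_map x : {ffun 'I_a * 'I_a -> 'I_H.+1} :=
  [ffun u => if u \in cells then x u.1 u.2 else ord0].

Definition map_to_pp (f : {ffun 'I_a * 'I_a -> 'I_H.+1}) : 'M['I_H.+1]_a :=
  \matrix_(i, j) f (rep i j).

Lemma card_pp_set : pp_count a H = #|order_maps below H false cells H.+1|.
Proof.
apply: (@eq_card_cancel _ _ _ _ pp_to_map map_to_pp) => x xP.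
- apply/order_mapsP; split.
  + by move=> u _; rewrite ltn_ord.
  + by move=> u /negPf uC; rewrite ffunE uC.
  + by move=> u v uC vC uv; rewrite !ffunE uC vC addn0 pp_below.
- have /pp_setP[_ _ symx] := xP; apply/matrixP => i j.
  rewrite mxE ffunE rep_cells /rep; case: ifPn => //.
  rewrite !inE /= => nC; apply: symx; lia.
- have /order_mapsP[_ _ mono] := xP.
  have mono' (i j i' j' : 'I_a) : below (i', j') (i, j) ->
      (x (rep i' j') <= x (rep i j))%N.
    rewrite -below_rep => /(mono _ _ (rep_cells _ _) (rep_cells _ _)).
    by rewrite addn0.
  apply/pp_setP; split=> [i i' j e|i j j' e|i j off]; rewrite !mxE.
  + by apply: mono'; apply/and3P; split=> /=; lia.
  + by apply: mono'; apply/and3P; split=> /=; lia.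
  + by rewrite rep_sym.
- have /order_mapsP[_ x0 _] := xP; apply/ffunP => u; rewrite ffunE mxE.
  by case: ifPn => [/rep_id->|/x0->].
Qed.

End SymmetricPartitions.

(** * The theorem *)

Lemma pp_deg_even k : pp_deg k.*2 = (k * k * 2 + k * 2)%N.
Proof.
rewrite /pp_deg (_ : k.*2 * k.*2.+1 = (k * k.*2.+1) * 2)%N; last by lia.
rewrite mulnK //.
by rewrite -muln2 mulnK //; lia.
Qed.

Lemma pp_deg_odd k : pp_deg k.*2.+1 = (k * k * 2 + k * 4 + 1)%N.
Proof.
rewrite /pp_deg (_ : k.*2.+1 * k.*2.+2 = (k.*2.+1 * k.+1) * 2)%N; last by lia.
rewrite mulnK //.
by rewrite (_ : k.*2.+1 %/ 2 = k)%N; lia.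
Qed.

Lemma odd_pp_deg_alpha a : odd (pp_deg a + alpha a).
Proof.
rewrite /alpha -(odd_double_half a); move: (odd a) a./2 => b k.
by case: b;
  rewrite /= ?add1n ?add0n ?pp_deg_odd ?pp_deg_even /= odd_double /=; lia.
Qed.

Lemma pp_deg_split a : (0 < a)%N ->
  (pp_deg a = ((a - 1) ^ 2) %/ 2 + (2 * a - 1) + alpha a)%N.
Proof.
rewrite /alpha -(odd_double_half a); move: (odd a) a./2 => b k.
case: b; rewrite /= ?add1n ?add0n ?pp_deg_odd ?pp_deg_even /= odd_double /=.
  rewrite (_ : (k.*2.+1 - 1) ^ 2 = (k * k * 2) * 2)%N ?mulnK //; first by lia.
  by rewrite subn1 /= -mulnn; lia.
case: k => // k _.
rewrite (_ : (k.+1.*2 - 1) ^ 2 = (k * k * 2 + k * 2) * 2 + 1)%N; last first.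
  by rewrite doubleS subn1 /= -mulnn; lia.
by rewrite divnMDl // addn0; lia.
Qed.

Theorem theorem1p3 (a : nat) (ha : (1 <= a)%N) :
  exists A : {poly rat},
    unique (extends_count a) A /\
    size A = (pp_deg a).+1 /\
    exists p : {poly rat},
      unique (fun q : {poly rat} =>
                q != 0 /\ even_polynomial q /\ factorization a A q) p /\
      size p = (((a - 1) ^ 2) %/ 2).+1 /\
      (den p %| (pp_deg a)`! %/ (2 * a - 1)`!)%N.
Proof.
have cells0 : cells a != set0.
  by apply/set0Pn; exists (rep (Ordinal ha) (Ordinal ha)); apply: rep_cells.
have covers := @corank_below a.
have h_incr (u v : 'I_a * 'I_a) : below u v -> (corank u < corank v)%N.
  by move=> uv; rewrite (covers _ _ uv).
(* A chain of m = H + 1 elements holds the entries 0, ..., H. *)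
pose W := omega (@below a) (cells a); pose A := W \Po ('X + 1%:P).
have sizeW : size W = (pp_deg a).+1 by rewrite (size_omega h_incr) card_cells.
have countA : extends_count a A.
  move=> H; rewrite horner_comp !hornerE natr1 card_pp_set.
  exact: omega_order_maps.
have sizeA : size A = (pp_deg a).+1 by rewrite size_comp_poly2 ?size_XaddC.
exists A; split; last split=> //.
  by split=> // A' countA'; apply: poly_nat_ext => H; rewrite countA countA'.
pose F := A \Po ('X - a%:R%:P).
have hornerF x : F.[x] = W.[x - a%:R + 1] by rewrite !horner_comp !hornerE.
have natl : (2 * a - 2)%N%:R = (a%:R - 1) *+ 2 :> rat.
  by rewrite natrB ?natrM; [ring | lia].
have sizeF : size F = (pp_deg a).+1 by rewrite size_comp_poly2 ?size_XsubC.
have symF : F \Po (- 'X) = (-1) ^+ pp_deg a *: F.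
  apply: poly_nat_ext => n; rewrite horner_comp hornerZ !hornerF -card_cells.
  rewrite -(omega_symmetry covers (@corank_le a) (@below_up a) (@below_down a)).
  by rewrite natl hornerN hornerX; congr (W.[_]); ring.
have rootF i : (i < 2 * a - 1)%N -> F.[i%:R - (a%:R - 1)] = 0.
  move=> lti; rewrite hornerF.
  have -> : i%:R - (a%:R - 1) - a%:R + 1 = - (2 * a - 2 - i)%N%:R :> rat.
    by rewrite natrB ?natl; [ring | lia].
  apply: (omega_root covers (@corank_le a) (@below_up a) (@below_down a)) => //.
  exact: leq_subr.
have intF : (pp_deg a)`!%:R *: F \is a polyOver Num.int.
  rewrite /F /A -!comp_polyZ; apply: polyOver_comp.
    apply: polyOver_comp; last by rewrite polyOverXaddC rpred1.
    by rewrite -card_cells; apply: omega_int.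
  by rewrite polyOverXsubC natr_int.
have le_alpha : (alpha a <= 1)%N by rewrite /alpha; case: odd.
have [p [uniq_p size_p den_p]] := symmetric_factorization ha
  (odd_pp_deg_alpha a) le_alpha sizeF symF rootF intF (pp_deg_fact_dvd a).
exists p; split; first exact: uniq_p.
split=> //.
by have := pp_deg_split ha; lia.
Qed.
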